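(* Let $(\Xi,d_\Xi)$ be a complete metric space and $\{\theta_t:t\in\mathbb{R}\}$ a group of continuous operators on $\Xi$ such that $(t,\sigma)\mapsto\theta_t\sigma$ is continuous. Let $g\in\Xi$ and $\Sigma=\mathcal{H}_\Xi(g)$. Let $\{U_\sigma(t,s):t\ge s\}_{\sigma\in\Sigma}$ be a system of evolution processes in the Banach space $X$ with a closed, bounded, uniformly absorbing set $\mathcal{B}\subset X$. Suppose: (1) There is a Banach space $Y$ compactly embedded in $X$. (2) For every $t>0$ there is $\kappa(t)>0$ such that $\sup_{\sigma\in\Sigma}\|U_\sigma(t,0)x-U_\sigma(t,0)y\|_Y\le\kappa(t)\|x-y\|_X$ for all $x,y\in\mathcal{B}$. (3) There are exponents $\gamma,\theta>0$ and, for each $r>0$, a constant $C(r)$ such that for all $s\in\mathbb{R}$, $\sigma\in\Sigma$, $x,y\in\mathcal{B}$ and $t,\tilde t\in[0,r]$, $$\|U_\sigma(t+s,s)x-U_\sigma(\tilde t+s,s)y\|_X\le C(r)\left(\|x-y\|_X^\gamma+|t-\tilde t|^\theta\right).$$ (4) There exist constants $P\ge1$ and $\zeta>0$ such that for all $t\ge0$ and all $\xi_1,\xi_2\in\Xi$, $d_\Xi(\theta_t\xi_1,\theta_t\xi_2)\le Pe^{\zeta t}d_\Xi(\xi_1,\xi_2)$. (5) For all $t\ge1$, $\sigma_1,\sigma_2\in\Sigma$ and $x\in\mathcal{B}$, $$\|U_{\sigma_1}(t,0)x-U_{\sigma_2}(t,0)x\|_X\le L(t)\,d_\Xi(\sigma_1,\sigma_2),$$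 where $1\le L(t)\le c_1e^{\beta t}$ for all $t\ge1$, for some constants $c_1,\beta>0$. Suppose also that there exist compact invariant sets $\Sigma_-,\Sigma_+\subset\Xi$ of finite box-counting dimension such that $\alpha(g)\subset\Sigma_-$, $\omega(g)\subset\Sigma_+$, and constants $\eta_1>0$, $\eta_2>0$, $C\ge1$ such that $$\mathrm{dist}(\theta_tg,\Sigma_-)\le Ce^{\eta_1t},\qquad\mathrm{dist}(\theta_tg,\Sigma_+)\le Ce^{-\eta_2t},\qquad t\in\mathbb{R}.$$ Let $\tau>0$ be the time when $\mathcal{B}$ absorbs itself, that is, $\bigcup_{\sigma\in\Sigma}U_\sigma(t,0)\mathcal{B}\subset\mathcal{B}$ for all $t\ge\tau$, and let $N_{\frac{1}{4\kappa(\tau)}}$ denote the number of balls of radius $\frac{1}{4\kappa(\tau)}$ in $X$ necessary to cover the unit ball $B_Y(0,1)$ of $Y$. Then the system $\{U_\sigma(t,s):t\ge s\}_{\sigma\in\Sigma}$ has a uniform attractor $\mathcal{A}_\Sigma$ of finite box-counting dimension, satisfying $$d_B(\mathcal{A}_\Sigma)\le\frac1\theta+\frac1\gamma\log_2N_{\frac{1}{4\kappa(\tau)}}+\left(\frac{(\beta+\zeta)\tau}{\log2}+1\right)\max\big(d_B(\Sigma_-),d_B(\Sigma_+)\big).$$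
   Context: $(X,\|\cdot\|_X)$ is a Banach space. An evolution process in $X$ is a family of continuous maps $U(t,s):X\to X$, $t\ge s$ real, with $U(s,s)=\mathrm{Id}_X$, $U(t,s)U(s,r)=U(t,r)$ for $t\ge s\ge r$, and such that for each $x\in X$ the map $(t,s)\mapsto U(t,s)x$ is continuous on $\{t\ge s\}$. A group of operators on $\Xi$ satisfies $\theta_0=\mathrm{Id}$, $\theta_t\theta_s=\theta_{t+s}$ for $t,s\in\mathbb{R}$. (The operators $\theta_t$ are unrelated to the Hölder exponent $\theta$.) A set $\Sigma'\subset\Xi$ is invariant if $\theta_t\Sigma'=\Sigma'$ for all $t\in\mathbb{R}$. The hull of $g$ is $\mathcal{H}_\Xi(g)=\overline{\{\theta_rg:r\in\mathbb{R}\}}$ (closure in $\Xi$); the symbol space $\Sigma$ is assumed compact. $\alpha(g)$ (resp. $\omega(g)$) is the set of all limits $\lim_n\theta_{t_n}g$ that exist along sequences $t_n\to-\infty$ (resp. $t_n\to\infty$). $\mathrm{dist}(\xi,S)=\inf_{\eta\in S}d_\Xi(\xi,\eta)$. A system of evolution processes $\{U_\sigma(t,s):t\ge s\}_{\sigma\in\Sigma}$, with $\Sigma\subset\Xi$ compact and invariant, is a family of evolution processes in $X$ such that $U_{\theta_h\sigma}(t,s)=U_\sigma(t+h,s+h)$ for all $\sigma\in\Sigma$, $t\ge s$, $h\in\mathbb{R}$. A set $\mathcal{B}\subset X$ is uniformly absorbing if for each bounded $B\subset X$ there is $t_B\ge0$ with $U_\sigma(t,0)B\subset\mathcal{B}$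 for all $t\ge t_B$ and all $\sigma\in\Sigma$. $\mathrm{dist}_H(A,B)=\sup_{x\in A}\inf_{y\in B}\|x-y\|_X$. The uniform attractor of $\{U_\sigma(t,s)\}_{\sigma\in\Sigma}$ is the compact set $\mathcal{A}_\Sigma\subset X$ that is the minimal closed set such that $\lim_{t\to\infty}\sup_{\sigma\in\Sigma}\mathrm{dist}_H(U_\sigma(t,0)B,\mathcal{A}_\Sigma)=0$ for every bounded $B\subset X$. For a subset $K$ of a metric space $Z$ and $r>0$, $N_Z(K,r)$ is the minimal number of open balls of $Z$ of radius $r$ needed to cover $K$, and $d_B(K)=\limsup_{r\to0}\frac{\log N_Z(K,r)}{-\log r}$ is the box-counting dimension. *)

(* Defs.v *)
From HB Require Import structures.
From mathcomp Require Import all_boot all_order all_algebra.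
From mathcomp Require Import all_classical all_reals all_analysis.

Set Implicit Arguments.
Unset Strict Implicit.
Unset Printing Implicit Defensive.

Import Order.TTheory GRing.Theory Num.Theory.
Import numFieldTopology.Exports numFieldNormedType.Exports.

Local Open Scope classical_set_scope.
Local Open Scope ring_scope.

#[short(type="completeMetricType")]
HB.structure Definition CompleteMetric (K : numDomainType) :=
  {T of CompletePseudoMetric K T & Metric K T}.

Section box_dimension.
Context {R : realType} {T : pseudoMetricType R}.

(* Open balls with arbitrary centres in the ambient space [T]; the value is
   +oo when no finite cover exists. *)
Definition covering_number (K : set T) (r : R) : \bar R :=
  ereal_inf [set n%:R%:E | n in
    [set n : nat | exists c : 'I_n -> T, K `<=` \bigcup_i ball (c i) r]].

(* Upper box-counting dimension; -oo for the empty set. *)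
Definition box_dim (K : set T) : \bar R :=
  limf_esup (fun r : R => (lne (covering_number K r) / (- ln r)%:E)%E) 0^'+.

End box_dimension.

Section symbol_space.
Context {R : realType} {Xi : metricType R}.
Implicit Types (theta : R -> Xi -> Xi) (g xi : Xi) (S : set Xi).

Definition continuous_group theta : Prop :=
  [/\ theta 0 = id,
      forall t s, theta t \o theta s = theta (t + s),
      forall t, continuous (theta t)
    & continuous (fun p : R * Xi => theta p.1 p.2)].

Definition invariant_set theta S : Prop := forall t, theta t @` S = S.

Definition hull theta g : set Xi := closure [set theta r g | r in [set: R]].

Definition alpha_limit theta g : set Xi :=
  [set xi | exists2 u : nat -> R,
    u n @[n --> \oo] --> -oo & theta (u n) g @[n --> \oo] --> xi].

Definition omega_limit theta g : set Xi :=
  [set xi | exists2 u : nat -> R,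
    u n @[n --> \oo] --> +oo & theta (u n) g @[n --> \oo] --> xi].

(* Extended-real valued, so that the distance to the empty set is +oo. *)
Definition dist_set xi S : \bar R :=
  ereal_inf [set (mdist xi eta)%:E | eta in S].

End symbol_space.

Section evolution_processes.
Context {R : realType} {X : completeNormedModType R} {Xi : metricType R}.
Implicit Types (U : Xi -> R -> R -> X -> X) (Sigma : set Xi).
Implicit Types (A B : set X).

(* [V t s] stands for V(t,s) and is only constrained for t >= s. *)
Definition evolution_process (V : R -> R -> X -> X) : Prop :=
  [/\ forall t s, s <= t -> continuous (V t s),
      forall s, V s s = id,
      forall t s r, r <= s -> s <= t -> V t s \o V s r = V t r
    & forall x, {within [set p : R * R | p.2 <= p.1],
        continuous (fun p : R * R => V p.1 p.2 x)}].

(* [U sigma] is only constrained for sigma in [Sigma]. *)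
Definition evolution_system (theta : R -> Xi -> Xi) Sigma U : Prop :=
  [/\ compact Sigma,
      invariant_set theta Sigma,
      forall sigma, Sigma sigma -> evolution_process (U sigma)
    & forall sigma, Sigma sigma -> forall t s h, s <= t ->
        U (theta h sigma) t s = U sigma (t + h) (s + h)].

Definition uniformly_absorbing Sigma U B : Prop :=
  forall D : set X, bounded_set D ->
    exists2 tD : R, 0 <= tD & forall t sigma, tD <= t -> Sigma sigma ->
      U sigma t 0 @` D `<=` B.

(* The supremum is taken in [0, +oo], hence is 0 for empty [A]. *)
Definition hausdorff_semidist A B : \bar R :=
  maxe 0%E (ereal_sup
    [set ereal_inf [set `|x - y|%:E | y in B] | x in A]).

Definition uniformly_attracting Sigma U A : Prop :=
  forall D : set X, bounded_set D ->
    ereal_sup [set hausdorff_semidist (U sigma t 0 @` D) A | sigma in Sigma]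
      @[t --> +oo] --> 0%E.

Definition uniform_attractor Sigma U A : Prop :=
  [/\ compact A, closed A, uniformly_attracting Sigma U A
    & forall A', closed A' -> uniformly_attracting Sigma U A' -> A `<=` A'].

End evolution_processes.

Definition compact_embedding {R : realType} {Y X : completeNormedModType R}
    (iota : {linear Y -> X}) : Prop :=
  [/\ injective iota, continuous iota
    & forall D : set Y, bounded_set D -> precompact (iota @` D)].

(* Main.v *)
Require Import Defs.
From HB Require Import structures.
From mathcomp Require Import all_boot all_order all_algebra.
From mathcomp Require Import all_classical all_reals all_analysis.
From mathcomp Require Import ring lra.

Import Order.TTheory GRing.Theory Num.Theory.
Import numFieldTopology.Exports numFieldNormedType.Exports.

Local Open Scope classical_set_scope.
Local Open Scope ring_scope.

(* Write F(t,e) = U_g(e,e-t)B for the part of the phase space reached at time e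
   from B after running for a time t. The attractor is the omega-limit set of B,
   and as the translates of g are dense in Sigma and U_sigma(t,0) is Lipschitz
   in sigma, it lies in the closure of the union of the F(t,e) over real e, for
   every t >= 1. Smoothing and compactness of the embedding cover
   U_sigma(n tau,0)B by N^n balls of radius R0/2^n. At scale r:
   - for |e| <= q tau, F(t,e) is contained in
     U_g(e,j tau)(U_g(j tau,j tau - n1 tau)B) with j = floor(e/tau); covering
     the inner set and a grid of step r^(1/vtheta) in e - j tau, Hoelder
     continuity with exponents gam and vtheta gives balls of radius O(r) when
     2^n1 is about r^(-1/gam);
   - for |e| > q tau, F(t,e) is contained in F(n2 tau,e), whose initial symbol
     is within r exp(-beta tau n2) of Sigmam or Sigmap; a cover of these sets at
     that scale suffices when 2^n2 is about 1/r.
   Since q may be taken of order log(1/r), counting the balls gives the bound,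
   provided gam <= 1. If gam > 1, Hoelder continuity of the identity forces B to
   be uniformly discrete, so the attractor is finite. *)

Set Implicit Arguments.
Unset Strict Implicit.

(** * Coverings and box-counting dimension *)

(** The bound [M] is real so that power laws in [r] can serve as counts directly;
    [covering_number_leP] is the link to [covering_number]. *)
Definition covered {R : realType} {T : pseudoMetricType R}
    (K : set T) (r M : R) : Prop :=
  exists2 s : seq T, (size s)%:R <= M &
    forall x, K x -> exists2 c, c \in s & ball c r x.

Section covered.
Context {R : realType} {T : pseudoMetricType R}.
Implicit Types (K : set T) (r M : R).

Lemma covering_number_leP K r M :
  (covering_number K r <= M%:E)%E <-> covered K r M.
Proof.
split=> [KM|[s sM sK]].
  have [n [c Kc] nM] : exists2 n : nat,
      (exists c : 'I_n -> T, K `<=` \bigcup_i ball (c i) r) & n%:R <= M.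
    have [M0|M0] := ltP M 0.
      have /ereal_inf_lt[_ [n _ <-]] : (covering_number K r < 0)%E.
        by rewrite (le_lt_trans KM)// lte_fin.
      by rewrite lte_fin ltrn0.
    (* Counts are integers, so one strictly below floor(M) + 1 is at most [M]. *)
    have /ereal_inf_lt[_ [n Kn <-]] :
        (covering_number K r < (Num.truncn M).+1%:R%:E)%E.
      by rewrite (le_lt_trans KM)// lte_fin truncnS_gt.
    by rewrite lte_fin ltr_nat ltnS truncn_ge_nat// => nM; exists n.
  exists [seq c i | i <- enum 'I_n]; first by rewrite size_map size_enum_ord.
  move=> x /Kc[i _ xi]; exists (c i) => //.
  by apply/mapP; exists i => //; rewrite mem_enum.
apply: (@le_trans _ _ (size s)%:R%:E); last by rewrite lee_fin.
apply: ereal_inf_lbound; exists (size s) => //=.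
exists (tnth (in_tuple s)) => x /sK[c cs cx].
by have /tnthP[i ci] : c \in in_tuple s by []; exists i => //; rewrite -ci.
Qed.

Lemma covered_sub K K' r r' M M' : K `<=` K' -> r' <= r -> M' <= M ->
  covered K' r' M' -> covered K r M.
Proof.
move=> KK' rr' MM' [s sM sK]; exists s; first exact: le_trans MM'.
by move=> x /KK'/sK[c cs cx]; exists c => //; exact: le_ball cx.
Qed.

Lemma coveredU K K' r M M' : covered K r M -> covered K' r M' ->
  covered (K `|` K') r (M + M').
Proof.
move=> [s sM sK] [s' sM' sK']; exists (s ++ s').
  by rewrite size_cat natrD lerD.
by move=> x [/sK|/sK'] [c cs cx]; exists c => //; rewrite mem_cat cs ?orbT.
Qed.

Lemma covered_bigcup (I : eqType) (s : seq I) (F : I -> set T) r M :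
  (forall i, i \in s -> covered (F i) r M) ->
  covered (\bigcup_(i in [set` s]) F i) r ((size s)%:R * M).
Proof.
elim: s => [_|i s IH sF].
  by exists [::]; [rewrite mul0r|move=> x [i]; rewrite /= in_nil].
rewrite /= -add1n natrD mulrDl mul1r.
apply: (@covered_sub _ (F i `|` \bigcup_(j in [set` s]) F j) _ r _ _ _ (lexx r) (lexx _)).
  move=> x [j /=]; rewrite inE => /predU1P[->|js] jx; first by left.
  by right; exists j.
apply: coveredU; first by apply: sF; rewrite mem_head.
by apply: IH => j js; apply: sF; rewrite inE js orbT.
Qed.

(** Each ball meeting [K] is replaced by the ball of twice the radius about a point of [K] in it.
    The smoothing and Lipschitz estimates need such centres. *)
Lemma covered_centered K r M : covered K r M ->
  exists s : seq T, [/\ (size s)%:R <= M, forall c, c \in s -> K c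
    & forall x, K x -> exists2 c, c \in s & ball c (r + r) x].
Proof.
case=> s sM sK.
have [->|/set0P[x0 Kx0]] := eqVneq K set0.
  by exists [::]; split => //; rewrite (le_trans _ sM).
(* For a ball that misses [K] the default [x0] is returned, which still lies in [K]. *)
pose h c : T := xget x0 [set x | K x /\ ball c r x].
have Kh c : K (h c) by rewrite /h; case: xgetP => [y ->[]|].
exists [seq h c | c <- s]; split.
- by rewrite size_map.
- by move=> _ /mapP[c _ ->].
- move=> x Kx; have [c cs cx] := sK _ Kx.
  exists (h c); first exact: map_f.
  have ch : ball c r (h c).
    by rewrite /h; case: xgetP => [y -> []//|/(_ x)[]].
  exact: ball_triangle (ball_sym ch) cx.
Qed.

Lemma covered_closure K r M : 0 < r ->
  covered K r M -> covered (closure K) (r + r) M.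
Proof.
move=> r0 [s sM sK]; exists s => // x /(_ _ (nbhsx_ballx x r r0))[y [/sK]].
move=> [c cs cy] xy; exists c => //.
exact: ball_triangle cy (ball_sym xy).
Qed.

(** A limsup below [s] gives log N <= s (-log r) for all small r; keeping r < 1 makes the
    denominator positive. *)
Lemma box_dim_lt_covered K (s : R) : (box_dim K < s%:E)%E ->
  exists2 r0 : R, 0 < r0 & forall r, 0 < r < r0 -> covered K r (r `^ (- s)).
Proof.
rewrite /box_dim limf_esupE => /ereal_inf_lt[_ [V V0 <-] Vs].
have [r0 r00 r0V] : exists2 r0 : R, 0 < r0 & forall r, 0 < r < r0 -> V r.
  move: V0; rewrite /at_right /= /within /= => /nbhs_ballP[e /= e0 eV].
  exists e => // r /andP[r0 re]; apply: eV => //.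
  by rewrite /ball /= sub0r normrN gtr0_norm.
exists (Num.min r0 1); first by rewrite lt_min r00 ltr01.
move=> r /andP[r_gt0]; rewrite lt_min => /andP[rr0 r1].
apply/covering_number_leP.
have lnr : 0 < - ln r by rewrite oppr_gt0 ln_lt0// r_gt0.
have : (lne (covering_number K r) / (- ln r)%:E <= s%:E)%E.
  apply: (le_trans _ (ltW Vs)); apply: ereal_sup_ubound.
  by exists r => //; apply: r0V; rewrite r_gt0.
rewrite inver gt_eqF// lee_pdivrMr// -EFinM => lnrs.
have N0 : (0 <= covering_number K r)%E.
  by apply: le_ereal_inf_tmp => _ [n _ <-]; rewrite lee_fin.
rewrite -lee_lne.
- rewrite lne_EFin ?powR_gt0// (le_trans lnrs)//.
  by rewrite ln_powR mulNr mulrN.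
- by rewrite in_itv /= N0 leey.
- by rewrite in_itv /= leey andbT lee_fin powR_ge0.
Qed.

(** Constant factors in the radius and in the count do not affect the dimension: for every e > 0
    they are absorbed by r^(-e) once r is small. *)
Lemma box_dim_le_of_covered K (s a M r0 : R) : 0 < a -> 0 < r0 ->
  (forall r, 0 < r < r0 -> covered K (a * r) (M * r `^ (- s))) ->
  (box_dim K <= s%:E)%E.
Proof.
move=> a0 r00 Kcov; apply/lee_addgt0Pr => e e0.
pose b := Num.max 1 (M * a `^ s).
have b0 : 0 < b by rewrite lt_max ltr01.
(* Below [a * r0] the hypothesis applies at radius r / a; below b^(-1/e) the factor r^(-e) exceeds
   [b], hence M a^s. *)
pose r1 := Num.min (Num.min 1 (a * r0)) (b `^ (- e^-1)).
have r10 : 0 < r1 by rewrite !lt_min ltr01 mulr_gt0// powR_gt0.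
rewrite /box_dim limf_esupE.
apply: (@le_trans _ _ (ereal_sup
  [set (lne (covering_number K r) / (- ln r)%:E)%E | r in [set r | 0 < r < r1]])).
  apply: ereal_inf_lbound; exists [set r | 0 < r < r1] => //.
  by near=> r => /=; apply/andP; split; near: r;
     [exact: nbhs_right_gt|exact: nbhs_right_lt].
apply: ge_ereal_sup => y [r /= /andP[r_gt0]].
rewrite !lt_min => /andP[/andP[r1' rar0] rb] <-.
have lnr : 0 < - ln r by rewrite oppr_gt0 ln_lt0// r_gt0.
rewrite inver gt_eqF// lee_pdivrMr//.
have /covering_number_leP Nr : covered K r (r `^ (- (s + e))).
  have ra : a * (r / a) = r by rewrite mulrCA divff ?mulr1// gt_eqF.
  have rar : 0 < r / a < r0 by rewrite divr_gt0//= ltr_pdivrMr// mulrC.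
  have := Kcov _ rar; rewrite ra; apply: covered_sub => //.
  rewrite powRM ?invr_ge0 ?(ltW a0) ?(ltW r_gt0)// -powR_inv1 ?(ltW a0)//.
  rewrite -powRrM mulN1r opprK.
  rewrite opprD powRD ?(gt_eqF r_gt0) ?implybT//.
  rewrite mulrCA ler_wpM2l ?powR_ge0//.
  apply: (@le_trans _ _ b); first by rewrite le_max lexx orbT.
  rewrite powRN -(@invrK _ b) lef_pV2 ?posrE ?powR_gt0 ?invr_gt0//.
  have := @ge0_ler_powR _ e (ltW e0) r (b `^ (- e^-1)).
  rewrite -powRrM mulNr mulVf ?gt_eqF// powR_inv1 ?(ltW b0)//; apply.
  - by rewrite nnegrE ltW.
  - by rewrite nnegrE powR_ge0.
  - exact: ltW.
have N0 : (0 <= covering_number K r)%E.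
  by apply: le_ereal_inf_tmp => _ [n _ <-]; rewrite lee_fin.
apply: (@le_trans _ _ (lne (r `^ (- (s + e)))%:E)).
  rewrite lee_lne//; first by rewrite in_itv /= N0 leey.
  by rewrite in_itv /= leey andbT lee_fin powR_ge0.
by rewrite lne_EFin ?powR_gt0// ln_powR mulNr -mulrN EFinM EFinD.
Unshelve. all: by end_near. Qed.

Lemma covering_number_ge1 K r : K !=set0 -> (1%:E <= covering_number K r)%E.
Proof.
move=> [x Kx]; apply: le_ereal_inf_tmp => _ [[|n] [c Kc] <-].
  by have [[]] := Kc _ Kx.
by rewrite lee_fin ler1n.
Qed.

Lemma box_dim_ge0 K : K !=set0 -> (0 <= box_dim K)%E.
Proof.
move=> K0; rewrite /box_dim limf_esupE.
apply: le_ereal_inf_tmp => _ [V V0 <-].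
have /filter_ex[r [Vr /andP[r0 r1]]] : (0 : R)^'+ [set r | V r /\ 0 < r < 1].
  near=> r; split; first by near: r.
  by apply/andP; split; near: r; [exact: nbhs_right_gt|exact: nbhs_right_lt].
apply: (@le_trans _ _ (lne (covering_number K r) / (- ln r)%:E)%E).
  have lnr : 0 < - ln r by rewrite oppr_gt0 ln_lt0// r0.
  by rewrite inver gt_eqF// lee_pdivlMr// mul0e lne_ge0 covering_number_ge1.
by apply: ereal_sup_ubound; exists r.
Unshelve. all: by end_near. Qed.

Lemma covering_number_fin K r M : covered K r M ->
  exists n : nat, covering_number K r = n%:R%:E /\ covered K r n%:R.
Proof.
move=> Kcov; have [|n /asboolP Kn nmin] :=
    @ex_minnP (fun n : nat => `[< covered K r n%:R >]).
  exists (Num.truncn M).+1; apply/asboolP.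
  by apply: covered_sub Kcov => //; apply: ltW; exact: truncnS_gt.
exists n; split=> //; apply/le_anti/andP; split; first exact/covering_number_leP.
apply: le_ereal_inf_tmp => _ [k Kk <-]; rewrite lee_fin ler_nat.
apply/nmin/asboolP/covering_number_leP.
by apply: ereal_inf_lbound; exists k.
Qed.

(** A ball of radius 2r centred in [K] contains no other point of [K], so [K] is finite and its
    covering numbers stay bounded as the radius tends to 0. *)
Lemma box_dim_separated K r M : 0 < r -> covered K r M ->
  (forall x y, K x -> K y -> ball x (r + r) y -> x = y) -> (box_dim K <= 0)%E.
Proof.
move=> r0 /covered_centered[s [sM sK Ks]] Ksep.
apply: (@box_dim_le_of_covered K 0 1 M 1) => // r' /andP[r'0 _].
rewrite mul1r oppr0 powRr0 mulr1; exists s => // x Kx.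
have [c cs cx] := Ks x Kx; exists c => //.
by rewrite (Ksep c x) => //; [exact: ballxx|exact: sK].
Qed.

End covered.

(** For distinct points, division by the distance gives 1 <= C |x - y|^(gam - 1), which bounds the
    distance from below. *)
Lemma holder_gt1_separated {R : realType} {X : normedModType R} (B : set X)
    (C gam : R) : 1 < gam ->
  (forall x y, B x -> B y -> `|x - y| <= C * `|x - y| `^ gam) ->
  exists2 e : R, 0 < e & forall x y, B x -> B y -> `|x - y| < e -> x = y.
Proof.
move=> gam1 CB; pose M := Num.max 1 C.
have M0 : 0 < M by rewrite lt_max ltr01.
have g0 : 0 < gam - 1 by rewrite subr_gt0.
exists (M `^ (- (gam - 1)^-1)) => [|x y Bx By xye]; first exact: powR_gt0.
apply/eqP; rewrite -subr_eq0 -normr_eq0; apply/negPn/negP => xy0.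
have d0 : 0 < `|x - y| by rewrite lt_neqAle eq_sym xy0 normr_ge0.
have := CB _ _ Bx By; apply/negP; rewrite -ltNge.
have -> : `|x - y| `^ gam = `|x - y| * `|x - y| `^ (gam - 1).
  by rewrite mulr_powRB1// (lt_trans ltr01).
rewrite mulrCA gtr_pMr//; apply: (@le_lt_trans _ _ (M * `|x - y| `^ (gam - 1))).
  by rewrite ler_wpM2r ?powR_ge0// le_max lexx orbT.
rewrite -ltr_pdivlMl// mulr1.
have -> : M^-1 = (M `^ (- (gam - 1)^-1)) `^ (gam - 1).
  by rewrite -powRrM mulNr mulVf ?gt_eqF// powR_inv1// ltW.
by rewrite gt0_ltr_powR// nnegrE ?powR_ge0.
Qed.

(** * Omega-limit sets and uniform attractors *)

Lemma precompact_covered {R : realType} {X : normedModType R} (K : set X) (r : R) :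
  precompact K -> 0 < r -> exists M : R, covered K r M.
Proof.
rewrite precompactE compact_cover => Kc r0.
have [|x Kx|D _ KD] := Kc X setT (fun x => ball x r).
- by move=> x _; exact: ball_open.
- by exists x => //; exact: ballxx.
exists (size (finmap.enum_fset D))%:R, (finmap.enum_fset D) => // x /subset_closure/KD[c cD cx].
by exists c.
Qed.

(** Otherwise the sets F t minus O generate a proper filter with a cluster point in [K]. That point
    lies in every closure of F t, hence in [O], a neighbourhood disjoint from all of these sets. *)
Lemma decreasing_bigcap_closure_sub {R : realType} {T : topologicalType}
    (K O : set T) (F : R -> set T) (t0 : R) :
  compact K -> open O -> (forall s t, s <= t -> F t `<=` F s) ->
  F t0 `<=` K -> \bigcap_t closure (F t) `<=` O -> exists t, F t `<=` O.
Proof.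
move=> Kc Oo Fdec FK FO; apply: contrapT => /forallNP nFO.
pose G := filter_from setT (fun t => F t `&` ~` O).
have GP : ProperFilter G.
  apply: filter_from_proper => [|t _].
    apply: filter_from_filter; first by exists t0.
    move=> s t _ _; exists (Num.max s t) => // x [Fx Ox].
    by split; split => //; apply: Fdec Fx; rewrite le_max lexx ?orbT.
  exact: nonsubset (nFO t).
have [|p [_]] := Kc G GP; first by exists t0 => // x [/FK].
rewrite clusterE => pG.
have GF t : closure (F t `&` ~` O) p by apply: pG; exists t.
have Op : O p by apply: FO => t _; apply: closure_subset (GF t) => x [].
by have [x [[_ nOx] Ox]] := GF t0 O (open_nbhs_nbhs (conj Oo Op)).
Qed.

Section attractor.
Context {R : realType} {X : completeNormedModType R} {Xi : metricType R}.
Variables (theta : R -> Xi -> Xi) (Sigma : set Xi) (U : Xi -> R -> R -> X -> X).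
Hypothesis Usys : evolution_system theta Sigma U.
Hypothesis Sigma0 : Sigma !=set0.
Implicit Types (sigma : Xi) (A B : set X).

Lemma theta_Sigma sigma h : Sigma sigma -> Sigma (theta h sigma).
Proof. by have [_ Si _ _] := Usys => Ss; rewrite -(Si h); exists sigma. Qed.

(** Cocycle form of the process: the translation identity restarts the second stage at time 0 with
    the shifted symbol. *)
Lemma evolution_split sigma (s t : R) x : Sigma sigma -> 0 <= s -> 0 <= t ->
  U sigma (s + t) 0 x = U (theta s sigma) t 0 (U sigma s 0 x).
Proof.
have [_ _ Up Ut] := Usys => Ss s0 t0.
rewrite Ut// add0r addrC; have [_ _ Uc _] := Up _ Ss.
by rewrite -(Uc (t + s) s 0)// lerDr.
Qed.

(** This epsilon form avoids extended-real suprema. Nonemptiness of [Sigma] keeps the outer supremum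
    nonnegative. *)
Lemma uniformly_attractingP A : uniformly_attracting Sigma U A <->
  forall D : set X, bounded_set D -> forall e, 0 < e ->
    exists T, forall t sigma x, T <= t -> Sigma sigma -> D x ->
      exists2 a, A a & `|U sigma t 0 x - a| < e.
Proof.
split=> [Aa D Db e e0|Aa D Db].
  have /fine_cvgP[ffin /cvgrPdist_lt/(_ e e0) fe] := Aa D Db.
  have [T [_ Te]] := filterI ffin fe.
  exists (T + 1) => t sigma x Tt Ss Dx.
  have /Te[tfin /=] : T < t by apply: lt_le_trans Tt; rewrite ltrDl.
  rewrite sub0r normrN => /(le_lt_trans (ler_norm _)); rewrite -lte_fin fineK//.
  move=> supe; have /ereal_inf_lt[_ [a Aa' <-]] :
      (ereal_inf [set `|U sigma t 0%R x - y|%:E | y in A] < e%:E)%E.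
    apply: le_lt_trans supe.
    apply: (@le_trans _ _ (hausdorff_semidist (U sigma t 0 @` D) A)); last first.
      by apply: ereal_sup_ubound; exists sigma.
    rewrite le_max; apply/orP; right; apply: ereal_sup_ubound.
    by exists (U sigma t 0 x) => //; exists x.
  by rewrite lte_fin => ?; exists a.
set f := fun t => ereal_sup _.
have f0 t : (0 <= f t)%E.
  have [sigma Ss] := Sigma0.
  apply: (@le_trans _ _ (hausdorff_semidist (U sigma t 0 @` D) A)).
    by rewrite le_max lexx.
  by apply: ereal_sup_ubound; exists sigma.
have fe e : 0 < e -> \forall t \near +oo, (f t <= e%:E)%E.
  move=> e0; have [T Te] := Aa D Db e e0.
  exists T; split; first exact: num_real.
  move=> t /ltW Tt; apply: ge_ereal_sup => _ [sigma Ss <-].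
  rewrite ge_max lee_fin (ltW e0)/=; apply: ge_ereal_sup => _ [_ [x Dx <-] <-].
  have [a Aa' ae] := Te _ _ _ Tt Ss Dx.
  by apply: ge_ereal_inf; exists `|U sigma t 0 x - a|%:E; [exists a|rewrite lee_fin ltW].
apply/fine_cvgP; split.
  apply: filterS (fe 1 ltr01) => t ft1.
  by rewrite ge0_fin_numE// (le_lt_trans ft1)// ltry.
apply/cvgrPdist_le => e e0; apply: filterS (fe e e0) => t fte /=.
rewrite sub0r normrN ger0_norm ?fine_ge0//.
by rewrite -lee_fin fineK// ge0_fin_numE// (le_lt_trans fte)// ltry.
Qed.

(** Intersecting the closures over all [t] gives the uniform omega-limit set of [B]. *)
Definition orbit_tail B (t : R) : set X :=
  [set y | exists s sigma x, [/\ t <= s, Sigma sigma, B x & y = U sigma s 0 x]].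

(** The tails decrease and end up in a compact set, so they enter every neighbourhood of [A];
    bounded sets enter [B] first and are then attracted too. *)
Lemma uniform_attractor_omega B (K : set X) (T0 : R) :
  bounded_set B -> B !=set0 -> uniformly_absorbing Sigma U B ->
  compact K -> orbit_tail B T0 `<=` K ->
  let A := \bigcap_t closure (orbit_tail B t) in
  uniform_attractor Sigma U A /\ A !=set0.
Proof.
move=> Bb [x0 Bx0] Babs Kc BK A.
have tail_dec s t : s <= t -> orbit_tail B t `<=` orbit_tail B s.
  by move=> st _ [u [sigma [x [tu Ss Bx ->]]]]; exists u, sigma, x; split => //; exact: le_trans tu.
have Acl : closed A by apply: closed_bigI => t _; exact: closed_closure.
have attr O : open O -> A `<=` O -> exists t, orbit_tail B t `<=` O.
  by move=> Oo AO; exact: decreasing_bigcap_closure_sub Kc Oo tail_dec BK AO.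
have [sigma0 Ss0] := Sigma0.
have A0 : A !=set0.
  apply/set0P/negP => /eqP A0; have [|t] := attr set0 open0; first by rewrite A0.
  by move=> /(_ (U sigma0 t 0 x0)); apply; exists t, sigma0, x0.
have XH : hausdorff_space X by exact: norm_hausdorff.
split=> //; split => //.
- apply: (subclosed_compact Acl Kc).
  have /closure_id -> : closed K by exact: compact_closed.
  by move=> x /(_ T0 I); exact: closure_subset.
- apply/uniformly_attractingP => D Db e e0.
  have [tD tD0 DB] := Babs D Db.
  have [|x Ax|t0 t0O] := attr (\bigcup_(a in A) ball a e).
  + by apply: bigcup_open => a _; exact: ball_open.
  + by exists x => //; exact: ballxx.
  (* Time [tD] brings [D] into [B], and the remaining time is at least [t0]; the maximum guards
     against a negative [t0]. *)
  exists (tD + Num.max t0 0) => t sigma x tT Ss Dx.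
  have tDt : 0 <= t - tD.
    by rewrite subr_ge0 (le_trans _ tT)// lerDl le_max lexx orbT.
  have /t0O[a Aa] : orbit_tail B t0 (U sigma t 0 x).
    exists (t - tD), (theta tD sigma), (U sigma tD 0 x); split.
    + by rewrite lerBrDl (le_trans _ tT)// lerD2l le_max lexx.
    + exact: theta_Sigma.
    + by apply: (DB tD sigma) => //; exists x.
    + by rewrite -evolution_split// subrKC.
  by rewrite -ball_normE /= distrC => ae; exists a.
- move=> A' A'cl /uniformly_attractingP/(_ B Bb) A'a p Ap.
  rewrite (closure_id A').1// => V /nbhs_ballP[e /= e0 eV].
  have e20 : 0 < e / 2 by rewrite divr_gt0.
  have [T AT] := A'a _ e20.
  (* Minimality: a tail state within e/2 of [p] is chosen so late that it is also within e/2 of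
     [A']. *)
  have [_ [[s [sigma [x [Ts Ss Bx ->]]]]]] := Ap T I _ (nbhsx_ballx p _ e20).
  have [a A'a' ae] := AT _ _ _ Ts Ss Bx.
  move=> px; exists a; split => //; apply: eV.
  rewrite [e]splitr; apply: ball_triangle px _.
  by rewrite -ball_normE.
Qed.

End attractor.

(** * Choice of the discretisation parameters at a given scale *)

Section scales.
Context {R : realType}.
Implicit Types (w s b y : R) (n : nat).

Lemma exists_exp2_between y : 1 <= y -> exists n, y <= 2 ^+ n <= 2 * y.
Proof.
move=> y1; have y0 : 0 <= y by exact: le_trans y1.
have [|n yn nmin] := @ex_minnP (fun n => y <= 2 ^+ n).
  exists (Num.truncn y).+1; apply: ltW; apply: lt_le_trans (truncnS_gt y) _.
  by rewrite -natrX ler_nat ltnW// ltn_expl.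
exists n; rewrite yn /=; case: n yn nmin => [|n] yn nmin.
  by rewrite expr0 (le_trans y1)// ler_peMl// ler1n.
rewrite exprS ler_pM2l//; rewrite leNgt; apply/negP => yn'.
by have := nmin n (ltW yn'); rewrite ltnn.
Qed.

(** Exponentials in [n] become powers of 2^n, which is comparable to a power of the scale; this is
    how ln 2 enters the exponents. *)
Lemma expR_mul_nat b n : expR (b * n%:R) = (2 ^+ n) `^ (b / ln 2).
Proof.
have l2 : (0 : R) < ln 2 by rewrite ln_gt0// ltr1n.
by rewrite -powR_mulrn// -powRrM mulrCA mulrC /powR gt_eqF// -mulrA divfK ?gt_eqF// mulrC.
Qed.

Lemma nat_exp_powR (N : nat) n : (0 < N)%N ->
  N%:R ^+ n = (2 ^+ n) `^ (ln N%:R / ln 2) :> R.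
Proof.
by move=> N0; rewrite -expR_mul_nat mulrC expRM_natl lnK// posrE ltr0n.
Qed.

Lemma exp2_powR_le n y s : 0 <= y -> 0 <= s -> 2 ^+ n <= 2 * y ->
  (2 ^+ n) `^ s <= 2 `^ s * y `^ s.
Proof.
move=> y0 s0 ny; rewrite -powRM//.
by rewrite ge0_ler_powR// nnegrE ?exprn_ge0 ?mulr_ge0.
Qed.

(* [w] is the inverse of the scale r, and [w^-1 * expR (- (beta * tau * n2%:R))]
   is the radius at which the asymptotic symbol sets are covered. *)
Lemma scale_choice (N : nat) (gam vtheta tau beta eta C d mu : R) :
  (0 < N)%N -> 0 < gam <= 1 -> 0 < vtheta -> 0 < tau -> 0 < beta -> 0 < eta ->
  1 <= C -> 0 <= d -> 0 < mu ->
  exists K : R, forall w, 1 < w -> ln 2 / tau <= ln w ->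
  exists n1 n2 q m, exists delta : R,
    [/\ [/\ w `^ gam^-1 <= 2 ^+ n1, w <= 2 ^+ n2, 0 < delta & delta `^ vtheta = w^-1],
        [/\ tau <= m%:R * delta, 1 <= n2%:R * tau & (n2 <= q)%N],
        C * expR (- (eta * ((q%:R - n2%:R) * tau))) < w^-1 * expR (- (beta * tau * n2%:R))
      & (q.*2.+1 * m.+1)%:R * N%:R ^+ n1 +
        2 * (w^-1 * expR (- (beta * tau * n2%:R))) `^ (- d) * N%:R ^+ n2
        <= K * w `^ (vtheta^-1 + gam^-1 * (ln N%:R / ln 2) +
                     (beta * tau / ln 2 + 1) * d + mu)].
Proof.
move=> N0 /andP[g0 g1] th0 tau0 beta0 eta0 C1 d0 mu0.
have l2 : (0 : R) < ln 2 by rewrite ln_gt0// ltr1n.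
set l := ln N%:R / ln 2.
have l0 : 0 <= l by rewrite divr_ge0// ?ln_ge0 ?ler1n// ltW.
(* [a0 + b0 * ln w] bounds 2q + 1, and ln w <= w^mu / mu absorbs the logarithm. The factor [tau + 2]
   comes from the time grid, 2^l and 2^f from rounding scales up to powers of 2. *)
set a0 := 5 + 2 * (ln C + beta * tau) / (eta * tau).
set b0 := 2 / ln 2 + 2 * (1 + beta * tau / ln 2) / (eta * tau).
set f := beta * tau * d / ln 2.
exists ((a0 + b0 / mu) * (tau + 2) * 2 `^ l + 2 * 2 `^ f * 2 `^ l).
move=> w w1 tw.
have w0 : 0 < w by exact: lt_trans w1.
have lw : 0 < ln w by rewrite ln_gt0.
have gi0 : 0 < gam^-1 by rewrite invr_gt0.
have thi0 : 0 < vtheta^-1 by rewrite invr_gt0.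
have wpow s : 0 <= s -> 1 <= w `^ s.
  by move=> s0; rewrite -(powRr0 w) ler_powR// ltW.
have [n1 /andP[n1w wn1]] := exists_exp2_between (wpow _ (ltW gi0)).
have [n2 /andP[n2w wn2]] := exists_exp2_between (ltW w1).
have n2l : ln w <= n2%:R * ln 2.
  by rewrite mulr_natl -lnXn// ler_ln ?posrE ?exprn_gt0.
have n2u : n2%:R <= 1 + ln w / ln 2.
  have : ln (2 ^+ n2) <= ln (2 * w) by rewrite ler_ln ?posrE ?exprn_gt0 ?mulr_gt0.
  rewrite lnXn// -(mulr_natl (ln 2)) lnM ?posrE// -ler_pdivlMr// mulrDl divff ?gt_eqF//.
pose delta := w `^ (- vtheta^-1).
have delta0 : 0 < delta by rewrite powR_gt0.
have tdelta : 0 <= tau / delta by rewrite divr_ge0 ?ltW.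
pose m := (Num.truncn (tau / delta)).+1.
(* [Z] solves C exp(-eta tau Z) = w^-1 exp(-beta tau n2), so any integer q - n2 above it
   suffices. *)
pose Z := (ln C + ln w + beta * tau * n2%:R) / (eta * tau).
have et0 : 0 < eta * tau by rewrite mulr_gt0.
have bt0 : 0 < beta * tau by rewrite mulr_gt0.
have lC : 0 <= ln C by rewrite ln_ge0.
have Z0 : 0 <= Z.
  by rewrite divr_ge0 ?(ltW et0)// !addr_ge0 ?(ltW lw)// mulr_ge0 ?(ltW bt0).
pose p := (Num.truncn Z).+1.
exists n1, n2, (n2 + p)%N, m, delta.
split.
- by split=> //; rewrite -powRrM mulNr mulVf ?gt_eqF// powR_inv1// ltW.
- split; last exact: leq_addr.
    by rewrite -ler_pdivrMr// ltW// truncnS_gt.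
  rewrite -ler_pdivrMr// div1r -(ler_pM2r l2) mulrC.
  exact: le_trans n2l.
- rewrite natrD [n2%:R + _]addrC addrK.
  have Zp : Z < p%:R by exact: truncnS_gt.
  have wE : w^-1 = expR (- ln w) by rewrite expRN lnK.
  have CE : C = expR (ln C) by rewrite lnK// posrE (lt_le_trans _ C1).
  rewrite wE {1}CE -!expRD ltr_expR.
  have : Z * (eta * tau) < p%:R * (eta * tau) by rewrite ltr_pM2r.
  by rewrite /Z divfK ?gt_eqF//; lra.
have Nn1 : N%:R ^+ n1 <= 2 `^ l * w `^ (gam^-1 * l).
  by rewrite nat_exp_powR// -/l (powRrM w) exp2_powR_le// powR_ge0.
(* Here 2^n2 is of order w, so N^n2 is of order w^l; as gam <= 1, this is at most the order w^(l /
   gam) of the other term. *)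
have Nn2 : N%:R ^+ n2 <= 2 `^ l * w `^ (gam^-1 * l).
  rewrite nat_exp_powR// (le_trans (exp2_powR_le _ _ wn2)) ?(ltW w0)//.
  by rewrite ler_wpM2l ?powR_ge0// ler_powR ?(ltW w1)// ler_peMl// invf_ge1.
have f0 : 0 <= f by rewrite divr_ge0 ?mulr_ge0// ltW.
have epsd : (w^-1 * expR (- (beta * tau * n2%:R))) `^ (- d) <=
    2 `^ f * w `^ ((beta * tau / ln 2 + 1) * d).
  rewrite powRM ?expR_ge0 ?invr_ge0 ?(ltW w0)// -(powR_inv1 (ltW w0)) -powRrM mulN1r opprK.
  rewrite -expRM mulrN mulNr opprK.
  have -> : beta * tau * n2%:R * d = beta * tau * d * n2%:R by rewrite mulrAC.
  rewrite expR_mul_nat.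
  have -> : (beta * tau / ln 2 + 1) * d = f + d by rewrite mulrDl mul1r /f mulrAC.
  rewrite powRD ?(gt_eqF w0) ?implybT// mulrA mulrC ler_wpM2r ?powR_ge0//.
  by rewrite exp2_powR_le// ltW.
have wmu : 1 <= w `^ mu by rewrite wpow// ltW.
have lnwmu : ln w <= w `^ mu / mu.
  rewrite ler_pdivlMr// mulrC -ln_powR.
  have := expR_ge1Dx (ln (w `^ mu)); rewrite lnK ?posrE ?powR_gt0//.
  by apply: le_trans; rewrite lerDr.
have a0_ge0 : 0 <= a0.
  by rewrite addr_ge0// mulr_ge0 ?invr_ge0 ?(ltW et0)// mulr_ge0// addr_ge0// ltW.
have b0_ge0 : 0 <= b0.
  rewrite addr_ge0 ?mulr_ge0 ?invr_ge0 ?(ltW et0) ?(ltW l2)//.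
  by rewrite addr_ge0// mulr_ge0 ?invr_ge0 ?(ltW l2)// ltW.
have qle : (n2 + p).*2.+1%:R <= (a0 + b0 / mu) * w `^ mu.
  apply: (@le_trans _ _ (a0 + b0 * ln w)); last first.
    rewrite [X in _ <= X]mulrDl lerD ?ler_peMr//.
    by rewrite -mulrA [mu^-1 * _]mulrC ler_wpM2l.
  apply: (@le_trans _ _ (2 * n2%:R + 2 * Z + 3)).
    have : p%:R <= Z + 1.
      by rewrite /p -natr1 lerD2r truncn_le.
    by rewrite -natr1 -muln2 natrM natrD; lra.
  have -> : a0 + b0 * ln w = 2 * (1 + ln w / ln 2) +
    2 * ((ln C + ln w + beta * tau * (1 + ln w / ln 2)) / (eta * tau)) + 3.
    by rewrite /a0 /b0; field; rewrite !gt_eqF.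
  rewrite lerD2r lerD ?ler_pM2l// ler_wpM2r ?invr_ge0 ?(ltW et0)//.
  by rewrite lerD2l ler_pM2l.
have mle : m.+1%:R <= (tau + 2) * w `^ vtheta^-1.
  apply: (@le_trans _ _ (tau / delta + 2)).
    have := truncn_le (tau / delta); rewrite tdelta => ?.
    by rewrite /m -addn2 natrD lerD2r.
  rewrite mulrDl lerD//; last by rewrite ler_peMr// wpow// ltW.
  by rewrite /delta powRN invrK.
set e1 := vtheta^-1 + gam^-1 * l; set e2 := (beta * tau / ln 2 + 1) * d.
have e20 : 0 <= e2 by rewrite mulr_ge0// addr_ge0// divr_ge0// ltW.
have wD s s' : w `^ (s + s') = w `^ s * w `^ s' by rewrite powRD// (gt_eqF w0) implybT.
(* Each summand lacks some of the powers of [w] in the common bound; the missing factors are at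
   least 1. *)
rewrite [X in _ <= X]mulrDl lerD//.
  apply: (@le_trans _ _ (((a0 + b0 / mu) * w `^ mu) * ((tau + 2) * w `^ vtheta^-1) * (2 `^ l * w `^ (gam^-1 * l)))).
    by rewrite ler_pM ?mulr_ge0 ?exprn_ge0// natrM ler_pM.
  rewrite /e1 !wD.
  set Wt := w `^ vtheta^-1; set Wl := w `^ (gam^-1 * l); set We := w `^ e2.
  set Wm := w `^ mu; set c := 2 `^ l.
  rewrite [X in _ <= X](_ : _ = (a0 + b0 / mu) * Wm * ((tau + 2) * Wt) * (c * Wl) * We).
    have [Wt0 Wl0] : 0 <= Wt /\ 0 <= Wl by rewrite !powR_ge0.
    have [Wm0 c0] : 0 <= Wm /\ 0 <= c by rewrite !powR_ge0.
    have ab0 : 0 <= a0 + b0 / mu by apply: addr_ge0 => //; apply: divr_ge0 => //; exact: ltW.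
    have tau2 : 0 <= tau + 2 by apply: addr_ge0 => //; exact: ltW.
    by apply: ler_peMr; [rewrite !mulr_ge0|exact: wpow].
  by ring.
apply: (@le_trans _ _ (2 * (2 `^ f * w `^ e2) * (2 `^ l * w `^ (gam^-1 * l)))).
  apply: ler_pM => //; last by rewrite ler_pM2l.
  by apply: mulr_ge0 => //; exact: powR_ge0.
rewrite /e1 !wD.
set Wt := w `^ vtheta^-1; set Wl := w `^ (gam^-1 * l); set We := w `^ e2.
set Wm := w `^ mu; set c := 2 `^ l; set cf := 2 `^ f.
rewrite [X in _ <= X](_ : _ = 2 * (cf * We) * (c * Wl) * (Wt * Wm)); last by ring.
apply: ler_peMr; first by do !apply: mulr_ge0 => //; exact: powR_ge0.
by apply: mulr_ege1 => //; apply: wpow; exact: ltW.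
Qed.

End scales.

(** * Covering the attractor *)

Lemma ball_normP {R : realType} {X : normedModType R} (c x : X) (r : R) :
  ball c r x <-> `|c - x| < r.
Proof. by rewrite -ball_normE. Qed.

Section dynamics.
Context {R : realType} {Xi : metricType R} {X Y : completeNormedModType R}.
Variables (iota : {linear Y -> X}) (theta : R -> Xi -> Xi) (g : Xi).
Variables (U : Xi -> R -> R -> X -> X) (B : set X).
Variables (kappa L : R -> R) (tau : R) (b0 : X) (R0 : R) (N : nat).
Let Sigma := hull theta g.
Hypothesis theta_group : continuous_group theta.
Hypothesis Usys : evolution_system theta Sigma U.
Hypothesis Bb0 : B b0.
Hypothesis BR0 : B `<=` ball b0 R0.
Hypothesis iota_compact : compact_embedding iota.
Hypothesis smoothing : forall t : R, 0 < t -> 0 < kappa t /\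
  forall sigma x y, Sigma sigma -> B x -> B y ->
    exists2 z : Y, iota z = U sigma t 0 x - U sigma t 0 y
                 & `|z| <= kappa t * `|x - y|.
Hypothesis L_ge1 : forall t, 1 <= t -> 1 <= L t.
Hypothesis symbol_lipschitz : forall t sigma1 sigma2 x, 1 <= t ->
  Sigma sigma1 -> Sigma sigma2 -> B x ->
  `|U sigma1 t 0 x - U sigma2 t 0 x| <= L t * mdist sigma1 sigma2.
Hypothesis tau_gt0 : 0 < tau.
Hypothesis tau_absorb : forall t sigma x, tau <= t -> Sigma sigma -> B x ->
  B (U sigma t 0 x).
Hypothesis N_cover : covered (iota @` ball (0 : Y) 1) (4 * kappa tau)^-1 N%:R.

Let R0_gt0 : 0 < R0.
Proof. by have := BR0 Bb0; rewrite -ball_normE /= subrr normr0. Qed.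

Lemma theta_g_Sigma h : Sigma (theta h g).
Proof. by apply: subset_closure; exists h. Qed.

Let Sigma0 : Sigma !=set0.
Proof. by exists (theta 0 g); exact: theta_g_Sigma. Qed.

Let thetaS := theta_Sigma Usys.
Let U_split := evolution_split Usys.

Lemma theta_add s t xi : theta t (theta s xi) = theta (s + t) xi.
Proof.
by have [_ thD _ _] := theta_group; rewrite addrC -(thD t s).
Qed.

Lemma U_id sigma x : Sigma sigma -> U sigma 0 0 x = x.
Proof. by have [_ _ Up _] := Usys => /Up[_ -> _ _]. Qed.

(** Differences from the image of [x0] lie in a [Y]-ball of radius kappa rho, and scaling the cover
    of the unit ball gives radius kappa rho / (4 kappa). The quarter leaves room for recentring
    while still halving the radius. *)
Lemma smoothing_cover sigma (E : set X) x0 rho : Sigma sigma ->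
  E `<=` B -> B x0 -> E `<=` ball x0 rho ->
  covered (U sigma tau 0 @` E) (rho / 4) N%:R.
Proof.
move=> Ss EB Bx0 Erho; have [s sN sK] := N_cover.
have [k0 kU] := smoothing tau_gt0.
exists [seq U sigma tau 0 x0 + (kappa tau * rho) *: c | c <- s].
  by rewrite size_map.
move=> _ [x Ex <-].
have [z zE zle] := kU _ _ _ Ss (EB _ Ex) Bx0.
have xrho : `|x - x0| < rho by have := Erho _ Ex; rewrite -ball_normE /= distrC.
have rho0 : 0 < rho by exact: le_lt_trans xrho.
have krho : 0 < kappa tau * rho by rewrite mulr_gt0.
have zk : `|z| < kappa tau * rho by apply: le_lt_trans zle _; rewrite ltr_pM2l.
have [|c cs] := sK (iota ((kappa tau * rho)^-1 *: z)).
  exists ((kappa tau * rho)^-1 *: z) => //.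
  rewrite -ball_normE /= sub0r normrN normrZ gtr0_norm ?invr_gt0//.
  by rewrite mulrC ltr_pdivrMr// mul1r.
move=> /ball_normP cz.
exists (U sigma tau 0 x0 + (kappa tau * rho) *: c); first exact: map_f.
apply/ball_normP.
have -> : U sigma tau 0 x0 + (kappa tau * rho) *: c - U sigma tau 0 x =
    (kappa tau * rho) *: (c - iota ((kappa tau * rho)^-1 *: z)).
  rewrite linearZ /= scalerBr scalerA divff ?(gt_eqF krho)// scale1r zE.
  by rewrite opprB addrCA addrA.
rewrite normrZ gtr0_norm// mulrC -ltr_pdivlMr//.
apply: lt_le_trans cz _; rewrite le_eqVlt; apply/orP; left; apply/eqP.
by field; rewrite !gt_eqF.
Qed.

Lemma B_absorb_nat n sigma x : Sigma sigma -> B x -> B (U sigma (n%:R * tau) 0 x).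
Proof.
case: n => [|n] Ss Bx; first by rewrite mul0r U_id.
by apply: tau_absorb => //; rewrite ler_peMl ?ler1n// ltW.
Qed.

(** Recentring after each smoothing step puts the centres back in the image of [B], so the next step
    applies; the radius halves and the count is multiplied by [N]. *)
Lemma iterated_cover n sigma : Sigma sigma ->
  exists s : seq X, [/\ (size s)%:R <= N%:R ^+ n :> R,
    forall c, c \in s -> (U sigma (n%:R * tau) 0 @` B) c &
    forall x, B x -> exists2 c, c \in s &
      ball c (R0 / 2 ^+ n) (U sigma (n%:R * tau) 0 x)].
Proof.
move=> Ss; elim: n => [|n [s [sN sB sK]]].
  exists [:: b0]; split=> // [c|x Bx].
    by rewrite inE => /eqP ->; exists b0 => //; rewrite mul0r U_id.
  exists b0; first by rewrite mem_head.
  by rewrite mul0r U_id// expr0 divr1; exact: BR0.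
have n0 : 0 <= n%:R * tau by rewrite mulr_ge0// ltW.
have US x : U sigma (n.+1%:R * tau) 0 x =
    U (theta (n%:R * tau) sigma) tau 0 (U sigma (n%:R * tau) 0 x).
  by rewrite -U_split ?(ltW tau_gt0)// -natr1 mulrDl mul1r.
pose F c := U (theta (n%:R * tau) sigma) tau 0 @`
  (U sigma (n%:R * tau) 0 @` B `&` ball c (R0 / 2 ^+ n)).
have Fcov c : c \in s -> covered (F c) (R0 / 2 ^+ n / 4) N%:R.
  move=> /sB[x Bx <-].
  apply: (smoothing_cover (x0 := U sigma (n%:R * tau) 0 x)).
  - exact: thetaS.
  - by move=> _ [[y By <-] _]; exact: B_absorb_nat.
  - exact: B_absorb_nat.
  - by move=> y [].
have /covered_centered[s' [s'N s'B s'K]] :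
    covered (U sigma (n.+1%:R * tau) 0 @` B) (R0 / 2 ^+ n / 4) (N%:R ^+ n.+1).
  apply: covered_sub (covered_bigcup Fcov) => //.
    move=> _ [x Bx <-]; have [c cs cx] := sK _ Bx.
    exists c => //; exists (U sigma (n%:R * tau) 0 x); last by rewrite US.
    by split => //; exists x.
  by rewrite exprS mulrC ler_wpM2l.
exists s'; split => // x Bx.
have [|c cs cx] := s'K (U sigma (n.+1%:R * tau) 0 x); first by exists x.
exists c => //; apply: le_ball cx; rewrite le_eqVlt; apply/orP; left; apply/eqP.
by rewrite exprS; field; rewrite expf_neq0.
Qed.

(** Over the last stage of length [T], U y = U b0 + (U y - U b0). The first term lies in a
    continuous image of the compact [Sigma], the second in the compact closure of an embedded
    [Y]-ball. *)
Lemma orbit_tail_compact : exists (K : set X) (T0 : R),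
  compact K /\ orbit_tail Sigma U B T0 `<=` K.
Proof.
(* [T] is at least 1, so that the Lipschitz estimate in the symbol is available. *)
pose T := tau + 1; have T0 : 0 < T by rewrite addr_gt0.
have T1 : 1 <= T by rewrite lerDr ltW.
have [k0 kU] := smoothing T0.
pose P := (fun sigma => U sigma T 0 b0) @` Sigma.
pose Q := closure (iota @` ball (0 : Y) (kappa T * R0)).
have Pc : compact P.
  apply: continuous_compact; last by have [] := Usys.
  apply/subspace_continuousP => sigma Ss; apply/cvgrPdist_lt => e e0.
  have L0 : 0 < L T by apply: lt_le_trans (L_ge1 T1).
  have /nbhs_ballP : nbhs sigma (ball sigma (e / L T)).
    by apply: nbhsx_ballx; rewrite divr_gt0.
  rewrite near_withinE => -[d d0 dS]; apply/nbhs_ballP; exists d => // xi /dS.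
  rewrite ballEmdist /= ltr_pdivlMr// mulrC => xie Sxi.
  exact: le_lt_trans (symbol_lipschitz T1 Ss Sxi Bb0) xie.
have Qc : compact Q.
  have [_ _ ic] := iota_compact; rewrite -precompactE; apply: ic.
  exists (kappa T * R0); split; first exact: num_real.
  by move=> M /ltW RM z /ball_normP; rewrite sub0r normrN => /ltW/le_trans; apply.
exists ((fun p : X * X => p.1 + p.2) @` (P `*` Q)), (tau + T); split.
  apply: continuous_compact; last exact: compact_setX.
  apply: continuous_subspaceT => p; exact: add_continuous.
move=> _ [s [sigma [x [Ts Ss Bx ->]]]].
have sT : tau <= s - T by rewrite lerBrDr.
have sT0 : 0 <= s - T by rewrite (le_trans (ltW tau_gt0)).
rewrite -(subrK T s) U_split ?(ltW T0)//.
set sigma' := theta (s - T) sigma; set y := U sigma (s - T) 0 x.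
have Ss' : Sigma sigma' by exact: thetaS.
have By : B y by exact: tau_absorb.
have [z zE zle] := kU _ _ _ Ss' By Bb0.
exists (U sigma' T 0 b0, iota z); last by rewrite /= zE addrC subrK.
split; first by exists sigma'.
apply: subset_closure; exists z => //; apply/ball_normP.
rewrite sub0r normrN; apply: le_lt_trans zle _; rewrite ltr_pM2l//.
by rewrite distrC; apply/ball_normP; exact: BR0.
Qed.

(** After a waiting time of at least [tau] the state is again in [B]; the symbol of the last stage
    lies in the hull and is approximated by translates of [g]. *)
Lemma orbit_tail_closure (t : R) : 1 <= t -> orbit_tail Sigma U B (t + tau) `<=`
  closure [set U (theta h g) t 0 x | h in setT & x in B].
Proof.
move=> t1 _ [s [sigma [x [ts Ss Bx ->]]]] V /nbhs_ballP[e /= e0 eV].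
have t0 : 0 <= t by exact: le_trans t1.
have st : tau <= s - t by rewrite lerBrDl.
have st0 : 0 <= s - t by rewrite (le_trans (ltW tau_gt0)).
move: eV; rewrite -(subrK t s) U_split//.
set sigma' := theta (s - t) sigma; set y := U sigma (s - t) 0 x => eV.
have Ss' : Sigma sigma' by exact: thetaS.
have By : B y by exact: tau_absorb.
have L0 : 0 < L t by apply: lt_le_trans (L_ge1 t1).
have [|_ [[h _ <-] sh]] := Ss' (ball sigma' (e / L t)).
  by apply: nbhsx_ballx; rewrite divr_gt0.
exists (U (theta h g) t 0 y); split; first by exists h => //; exists y.
apply: eV; apply/ball_normP.
apply: le_lt_trans (symbol_lipschitz t1 Ss' (theta_g_Sigma (h := h)) By) _.
by move: sh; rewrite ballEmdist /= ltr_pdivlMr// mulrC.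
Qed.

(** Recentring the symbol cover at translates of [g] turns radius 2 eps into 4 eps. Replacing a
    symbol by its centre costs 4 L eps, after which [iterated_cover] applies to the centre
    symbol. *)
Lemma tail_cover (H : set R) n (eps M : R) : 0 < eps -> 1 <= n%:R * tau ->
  covered [set theta h g | h in H] (eps + eps) M ->
  covered [set U (theta h g) (n%:R * tau) 0 x | h in H & x in B]
    (4 * L (n%:R * tau) * eps + R0 / 2 ^+ n) (M * N%:R ^+ n).
Proof.
move=> e0 nt /covered_centered[s [sM sH sK]].
pose F xi := [set U (theta h g) (n%:R * tau) 0 x |
  h in [set h | ball xi (eps + eps + (eps + eps)) (theta h g)] & x in B].
have Fcov xi : xi \in s ->
    covered (F xi) (4 * L (n%:R * tau) * eps + R0 / 2 ^+ n) (N%:R ^+ n).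
  move=> /sH[h Hh hxi].
  have Sxi : Sigma xi by rewrite -hxi; exact: theta_g_Sigma.
  have [s' [s'N _ s'K]] := iterated_cover n Sxi.
  exists s' => // _ [h' /= hh' [x Bx <-]].
  have [c cs cx] := s'K x Bx; exists c => //.
  rewrite addrC; apply: ball_triangle cx _; apply/ball_normP.
  apply: le_lt_trans (symbol_lipschitz nt Sxi (theta_g_Sigma (h := h')) Bx) _.
  have L0 : 0 < L (n%:R * tau) by apply: lt_le_trans (L_ge1 nt).
  rewrite (mulrC 4) -mulrA ltr_pM2l//.
  by move: hh'; rewrite ballEmdist /= => /lt_le_trans; apply; lra.
apply: covered_sub (covered_bigcup Fcov) => //.
  move=> _ [h Hh [x Bx <-]]; have [|xi xis xih] := sK (theta h g); first by exists h.
  by exists xi => //; exists h => //; exists x.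
by rewrite ler_wpM2r// exprn_ge0.
Qed.

Lemma near_symbols_covered (H : set R) (S : set Xi) (eps e M : R) :
  covered S eps M -> e < eps ->
  (forall h, H h -> (dist_set (theta h g) S <= e%:E)%E) ->
  covered [set theta h g | h in H] (eps + eps) M.
Proof.
move=> [s sM sS] ee HS; exists s => // _ [h Hh <-].
have /ereal_inf_lt[_ [xi Sxi <-]] : (dist_set (theta h g) S < eps%:E)%E.
  by rewrite (le_lt_trans (HS _ Hh))// lte_fin.
have [c cs cxi] := sS _ Sxi; rewrite lte_fin => xie.
exists c => //; apply: ball_triangle cxi _.
by apply: ball_sym; rewrite ballEmdist.
Qed.

(** * States reached at final times in a bounded window *)

Variables (C3 gam vtheta : R).
Hypothesis gam_gt0 : 0 < gam.
Hypothesis vtheta_gt0 : 0 < vtheta.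
Hypothesis holder : forall sigma x y (t t' : R), Sigma sigma -> B x -> B y ->
  0 <= t <= tau -> 0 <= t' <= tau ->
  `|U sigma t 0 x - U sigma t' 0 y|
    <= C3 * (`|x - y| `^ gam + `|t - t'| `^ vtheta).

(** Hölder continuity carries a cover of the states at time n tau through the further time [u], with
    the centres evolved for the fixed time [a]. The absolute value appears because no sign is
    assumed for [C3]. *)
Lemma phase_cover sigma n (a delta rho : R) : Sigma sigma -> 0 <= a <= tau ->
  `|C3| * ((R0 / 2 ^+ n) `^ gam + delta `^ vtheta) < rho ->
  covered [set U (theta (n%:R * tau) sigma) u 0 y |
             u in [set u | a <= u <= tau /\ u <= a + delta]
             & y in U sigma (n%:R * tau) 0 @` B]
    rho (N%:R ^+ n).
Proof.
move=> Ss atau rhoE; have [s [sN sB sK]] := iterated_cover n Ss.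
exists [seq U (theta (n%:R * tau) sigma) a 0 c | c <- s]; first by rewrite size_map.
move=> _ [u [/andP[au ut] uad] [_ [x Bx <-] <-]].
have [c cs cx] := sK x Bx.
exists (U (theta (n%:R * tau) sigma) a 0 c); first exact: map_f.
have /andP[a0 _] := atau.
have Bc : B c by have [y By <-] := sB c cs; exact: B_absorb_nat.
apply/ball_normP; apply: le_lt_trans rhoE.
apply: (le_trans (holder (@thetaS sigma (n%:R * tau) Ss) Bc (B_absorb_nat n Ss Bx) atau _)).
  by rewrite ut (le_trans a0).
apply: (@le_trans _ _ (`|C3| *
  (`|c - U sigma (n%:R * tau) 0 x| `^ gam + `|a - u| `^ vtheta))).
  by rewrite ler_wpM2r ?ler_norm// addr_ge0 ?powR_ge0.
rewrite ler_wpM2l// lerD//.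
  rewrite ge0_ler_powR ?(ltW gam_gt0) ?nnegrE ?normr_ge0 ?divr_ge0 ?exprn_ge0 ?(ltW R0_gt0)//.
  by apply/ltW/ball_normP.
rewrite ge0_ler_powR ?(ltW vtheta_gt0) ?nnegrE ?normr_ge0//.
  by move: au uad; lra.
by rewrite distrC ger0_norm ?subr_ge0// lerBlDl.
Qed.

Lemma core_cover n q m (t delta rho : R) : 0 < delta -> tau <= m%:R * delta ->
  (n.+2)%:R * tau <= t ->
  `|C3| * ((R0 / 2 ^+ n) `^ gam + delta `^ vtheta) < rho ->
  covered [set U (theta h g) t 0 x | h in [set h | `|h + t| <= q%:R * tau] & x in B]
    rho ((q.*2.+1 * m.+1)%:R * N%:R ^+ n).
Proof.
move=> d0 mtau nt rhoE.
(* The 2q + 1 indices enumerate the multiples of [tau] from -q tau to q tau. *)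
pose j (i : nat) : R := (i%:R - q%:R) * tau.
pose F (ik : nat * nat) := [set U (theta (j ik.1) g) u 0 y |
  u in [set u | ik.2%:R * delta <= u <= tau /\ u <= ik.2%:R * delta + delta]
  & y in U (theta (j ik.1 - n%:R * tau) g) (n%:R * tau) 0 @` B].
pose I := [seq (i, k) | i <- seq.iota 0 q.*2.+1, k <- seq.iota 0 m.+1].
have Fcov ik : ik \in I -> covered (F ik) rho (N%:R ^+ n).
  move=> _; have [kt|kt] := leP (ik.2%:R * delta) tau.
    have := phase_cover (theta_g_Sigma (h := j ik.1 - n%:R * tau)) _ rhoE.
    move=> /(_ (ik.2%:R * delta)); rewrite theta_add subrK; apply.
    by rewrite mulr_ge0// ltW.
  (* A grid point beyond [tau] gives an empty piece. *)
  exists [::]; first by rewrite exprn_ge0.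
  by move=> y [u /= [/andP[/(lt_le_trans kt) + ut]]]; rewrite ltNge ut.
apply: covered_sub (covered_bigcup Fcov) => //; last first.
  by rewrite size_allpairs !size_iota.
move=> _ [h /= hq [x Bx <-]]; move: hq; rewrite ler_norml => /andP[qe eq].
set e := h + t in qe eq.
have eq0 : 0 <= e / tau + q%:R.
  by rewrite -lerBlDr sub0r ler_pdivlMr// mulNr.
have /andP[ie ei] := truncn_itv eq0; set i := Num.truncn _ in ie ei.
have je : j i <= e by rewrite /j -ler_pdivlMr// lerBlDr.
have ej : e < j i + tau.
  have : (e / tau + q%:R) * tau < i.+1%:R * tau by rewrite ltr_pM2r.
  by rewrite mulrDl divfK ?gt_eqF// -natr1 /j; lra.
have i2q : (i < q.*2.+1)%N.
  rewrite ltnS -(@ler_nat R) (le_trans ie)// -addnn natrD lerD2r.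
  by rewrite ler_pdivrMr.
pose u := e - j i; have u0 : 0 <= u by rewrite subr_ge0.
have utau : u < tau by rewrite /u ltrBlDr addrC.
have ud : 0 <= u / delta by rewrite divr_ge0// ltW.
have /andP[ku uk] := truncn_itv ud; set k := Num.truncn _ in ku uk.
have kd : k%:R * delta <= u by rewrite -ler_pdivlMr.
have km : (k < m.+1)%N.
  rewrite ltnS -(@ler_nat R) (le_trans ku)// ler_pdivrMr//.
  exact: le_trans (ltW utau) mtau.
(* The running time [t] splits into t', then n tau up to the grid time [j i], then [u]. Since u <
   tau and t >= (n + 2) tau, t' is at least [tau] and the first stage ends in [B]. *)
pose t' := j i - n%:R * tau - h.
have nt0 : 0 <= n%:R * tau by rewrite mulr_ge0// ltW.
have t'tau : tau <= t'.
  by move: nt; rewrite /t' -!natr1 !mulrDl mul1r; move: utau; rewrite /u /e; lra.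
have t'0 : 0 <= t' by rewrite (le_trans _ t'tau)// ltW.
have Sh : Sigma (theta h g) by exact: theta_g_Sigma.
exists (i, k).
  by apply/allpairsP; exists (i, k); rewrite !mem_iota /= !add0n.
exists u => /=.
  rewrite kd (ltW utau); split => //.
  have : u <= k.+1%:R * delta by rewrite -ler_pdivrMr// ltW.
  by rewrite -natr1 mulrDl mul1r.
exists (U (theta (j i - n%:R * tau) g) (n%:R * tau) 0 (U (theta h g) t' 0 x)).
  by exists (U (theta h g) t' 0 x) => //; exact: tau_absorb.
have tE : t = t' + n%:R * tau + u by rewrite /t' /u /e; lra.
have tn0 : 0 <= t' + n%:R * tau by exact: addr_ge0.
rewrite [in RHS]tE [RHS]U_split// [X in _ = U _ _ _ X]U_split//.
rewrite !theta_add.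
by congr (U (theta _ g) _ _ (U (theta _ g) _ _ _)); rewrite /t'; lra.
Qed.

(** * Late and early symbols, and the cover of the attractor *)

Variables (Sigmam Sigmap : set Xi) (eta1 eta2 C : R).
Hypothesis eta1_gt0 : 0 < eta1.
Hypothesis eta2_gt0 : 0 < eta2.
Hypothesis C_ge1 : 1 <= C.
Hypothesis dist_Sigmam : forall t,
  (dist_set (theta t g) Sigmam <= (C * expR (eta1 * t))%:E)%E.
Hypothesis dist_Sigmap : forall t,
  (dist_set (theta t g) Sigmap <= (C * expR (- (eta2 * t)))%:E)%E.

Lemma attractor_cover n1 n2 q m (delta eps rho Mm Mp : R) :
  0 < delta -> tau <= m%:R * delta -> 1 <= n2%:R * tau -> (n2 <= q)%N -> 0 < eps ->
  `|C3| * ((R0 / 2 ^+ n1) `^ gam + delta `^ vtheta) < rho ->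
  4 * L (n2%:R * tau) * eps + R0 / 2 ^+ n2 <= rho ->
  C * expR (- (Num.min eta1 eta2 * ((q%:R - n2%:R) * tau))) < eps ->
  covered Sigmam eps Mm -> covered Sigmap eps Mp ->
  covered (\bigcap_t closure (orbit_tail Sigma U B t)) (rho + rho)
    ((q.*2.+1 * m.+1)%:R * N%:R ^+ n1 + (Mm + Mp) * N%:R ^+ n2).
Proof.
move=> d0 mtau n2tau n2q e0 rho1 rho2 qeps covm covp.
(* This time is long enough for the core estimate with [n1], and it leaves (n1 + 2) tau for
   absorption into [B] before the last n2 tau. *)
pose t := (n1 + n2 + 2)%:R * tau.
have n2t : n2%:R * tau <= t by rewrite ler_pM2r// ler_nat addnAC leq_addl.
have n1t : n1.+2%:R * tau <= t by rewrite ler_pM2r// ler_nat addnAC addn2 leq_addr.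
have t1 : 1 <= t by exact: le_trans n2t.
have rho0 : 0 < rho.
  by apply: le_lt_trans rho1; rewrite mulr_ge0// addr_ge0 ?powR_ge0.
apply: (@covered_sub _ _ _
  (closure [set U (theta h g) t 0 x | h in setT & x in B]) _ _ _ _ _ (lexx _) (lexx _)).
  move=> x /(_ (t + tau) I) xt.
  apply: (@closed_closure X).
  by apply: closure_subset xt; exact: orbit_tail_closure.
apply: covered_closure => //.
have eta0 : 0 < Num.min eta1 eta2 by rewrite lt_min eta1_gt0.
(* These are the start times of the last stage of length n2 tau when the final time lies outside
   [-q tau, q tau]. *)
pose late := [set h : R | h <= - (q%:R * tau) \/ (q%:R - n2%:R) * tau <= h].
have symcov : covered [set theta h g | h in late] (eps + eps) (Mm + Mp).
  set c := C * _ in qeps.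
  have covm' := near_symbols_covered (H := [set h | h <= - (q%:R * tau)]) covm qeps.
  have covp' := near_symbols_covered (H := [set h | (q%:R - n2%:R) * tau <= h]) covp qeps.
  apply: covered_sub (coveredU (covm' _) (covp' _)) => //.
  - by move=> _ [h [hq|hq] <-]; [left|right]; exists h.
  - move=> h /= hq; apply: (le_trans (dist_Sigmam h)); rewrite lee_fin.
    rewrite ler_wpM2l ?(le_trans _ C_ge1)// ler_expR.
    rewrite -lerN2 opprK -mulrN.
    apply: (@le_trans _ _ (Num.min eta1 eta2 * (q%:R * tau))).
      by rewrite ler_wpM2l ?(ltW eta0)// ler_wpM2r ?(ltW tau_gt0)// gerBl.
    by rewrite ler_pM ?(ltW eta0) ?mulr_ge0 ?(ltW tau_gt0) ?ge_min ?lexx// lerNr.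
  - move=> h /= hq; apply: (le_trans (dist_Sigmap h)); rewrite lee_fin.
    rewrite ler_wpM2l ?(le_trans _ C_ge1)// ler_expR lerN2.
    rewrite ler_pM ?(ltW eta0) ?ge_min ?lexx ?orbT//.
    by rewrite mulr_ge0 ?(ltW tau_gt0)// subr_ge0 ler_nat.
have tailcov := tail_cover e0 n2tau symcov.
have tailcov' := covered_sub (@subset_refl _ _) rho2 (lexx _) tailcov.
apply: covered_sub (coveredU (core_cover q d0 mtau n1t rho1) tailcov') => //.
move=> _ [h _ [x Bx <-]].
have [hq|hq] := leP `|h + t| (q%:R * tau).
  by left; exists h => //; exists x.
right; exists (h + t - n2%:R * tau).
  move: hq; rewrite /late /= real_lter_normr ?num_real// => /orP[hq|hq].
    by right; move: hq; rewrite mulrBl; lra.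
  left; have : 0 <= n2%:R * tau by rewrite mulr_ge0// ltW.
  by move: hq; lra.
have tn2 : 0 <= t - n2%:R * tau by rewrite subr_ge0.
exists (U (theta h g) (t - n2%:R * tau) 0 x).
  apply: tau_absorb => //; last exact: theta_g_Sigma.
  rewrite -mulrBl -natrB ?ler_peMl ?(ltW tau_gt0)//; last by rewrite addnAC leq_addl.
  by rewrite addnAC addnK ler1n addn2.
rewrite -[t in RHS](subrK (n2%:R * tau)) [RHS]U_split//.
- by rewrite theta_add addrA.
- exact: theta_g_Sigma.
- by rewrite mulr_ge0// ltW.
Qed.

(** * From covers to the dimension bound *)

Variables (c1 beta d : R).
Hypothesis c1_gt0 : 0 < c1.
Hypothesis beta_gt0 : 0 < beta.
Hypothesis L_exp : forall t, 1 <= t -> L t <= c1 * expR (beta * t).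
Hypothesis gam_le1 : gam <= 1.
Hypothesis N_gt0 : (0 < N)%N.
Hypothesis d_ge0 : 0 <= d.
Hypothesis dim_Sigmam : (box_dim Sigmam <= d%:E)%E.
Hypothesis dim_Sigmap : (box_dim Sigmap <= d%:E)%E.

Lemma attractor_box_dim_le :
  (box_dim (\bigcap_t closure (orbit_tail Sigma U B t)) <=
    (vtheta^-1 + gam^-1 * (ln N%:R / ln 2) + (beta * tau / ln 2 + 1) * d)%:E)%E.
Proof.
set D := _ + _ + _.
have l2 : (0 : R) < ln 2 by rewrite ln_gt0// ltr1n.
set k := beta * tau / ln 2 + 1.
have k0 : 0 < k by rewrite addr_gt0// divr_gt0 ?mulr_gt0.
apply/lee_addgt0Pr => e e0; rewrite -EFinD.
(* The excess [e] is shared equally: k (d' - d) = e/2 makes room for the symbol covers, and [mu] =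
   e/2 for the logarithmic factors. *)
pose d' := d + e / (2 * k); pose mu := e / 2.
have mu0 : 0 < mu by rewrite divr_gt0.
have dd' : d < d' by rewrite ltrDl divr_gt0// mulr_gt0.
have d'0 : 0 <= d' by rewrite (le_trans d_ge0)// ltW.
have -> : D + e = vtheta^-1 + gam^-1 * (ln N%:R / ln 2) + k * d' + mu.
  by rewrite /D /d' /mu -/k; field; rewrite !gt_eqF.
have eta0 : 0 < Num.min eta1 eta2 by rewrite lt_min eta1_gt0.
have gam01 : 0 < gam <= 1 by rewrite gam_gt0.
have [K Kw] := scale_choice N_gt0 gam01 vtheta_gt0 tau_gt0 beta_gt0 eta0 C_ge1 d'0 mu0.
have ltd' (S : set Xi) : (box_dim S <= d%:E)%E -> (box_dim S < d'%:E)%E.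
  by move=> /le_lt_trans; apply; rewrite lte_fin.
have [rm rm0 covm] := box_dim_lt_covered (ltd' _ dim_Sigmam).
have [rp rp0 covp] := box_dim_lt_covered (ltd' _ dim_Sigmap).
(* In units of r, this adds the Hölder error, the error from replacing symbols, and the radius of
   the iterated cover. *)
pose a := `|C3| * (R0 `^ gam + 1) + 4 * c1 + R0.
have a0 : 0 < a.
  rewrite /a -addrA ltr_wpDl ?addr_gt0 ?mulr_gt0//.
  by rewrite mulr_ge0// addr_ge0// powR_ge0.
(* The radius is doubled by passing to the closure. The threshold ensures w = 1/r > 1, ln w >= ln 2
   / tau, and that the symbol covers exist at radius eps <= r. *)
apply: (@box_dim_le_of_covered _ _ _ _ (a + a) K
  (Num.min (Num.min 1 (expR (- (ln 2 / tau)))) (Num.min rm rp))).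
- by rewrite addr_gt0.
- by rewrite !lt_min ltr01 expR_gt0 rm0.
move=> r /andP[r0]; rewrite !lt_min => /andP[/andP[r1 rtau] /andP[rrm rrp]].
have w1 : 1 < r^-1 by rewrite invf_gt1.
have lw : ln 2 / tau <= ln r^-1.
  by rewrite lnV ?posrE// lerNr -ler_expR lnK ?posrE// ltW.
have [n1 [n2 [q [m [delta [[wn1 wn2 delta0 deltaE] [mtau n2tau n2q] qeps Nle]]]]]] :=
  Kw _ w1 lw.
rewrite invrK in deltaE qeps Nle.
set eps := r * _ in qeps Nle.
have eps0 : 0 < eps by rewrite mulr_gt0// expR_gt0.
have epsr : eps <= r.
  by rewrite ger_pMr// -expR0 ler_expR oppr_le0 !mulr_ge0// ltW.
have R0n1 : (R0 / 2 ^+ n1) `^ gam <= R0 `^ gam * r.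
  have rE : r = (r `^ gam^-1) `^ gam.
    by rewrite -powRrM mulVf ?gt_eqF// powRr1// ltW.
  rewrite [X in _ <= _ * X]rE -powRM ?powR_ge0 ?(ltW R0_gt0)//.
  apply: ge0_ler_powR; rewrite ?nnegrE ?(ltW gam_gt0) ?mulr_ge0 ?divr_ge0
    ?exprn_ge0 ?powR_ge0 ?(ltW R0_gt0)//.
  rewrite ler_pM2l// -[X in _ <= X]invrK lef_pV2 ?posrE ?exprn_gt0 ?invr_gt0 ?powR_gt0//.
  by rewrite -powRN -(powR_inv1 (ltW r0)) -powRrM mulN1r in wn1 *.
have R0n2 : R0 / 2 ^+ n2 <= R0 * r.
  by rewrite ler_pM2l// -[X in _ <= X]invrK lef_pV2 ?posrE ?exprn_gt0 ?invr_gt0.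
(* The factor exp(-beta tau n2) in [eps] cancels the growth of [L]. *)
have Leps : L (n2%:R * tau) * eps <= c1 * r.
  apply: (@le_trans _ _ (c1 * expR (beta * (n2%:R * tau)) * eps)).
    by rewrite ler_wpM2r ?(ltW eps0)// L_exp.
  rewrite /eps mulrCA -(mulrA c1) -expRD.
  have -> : beta * (n2%:R * tau) + - (beta * tau * n2%:R) = 0 by ring.
  by rewrite expR0 mulr1 mulrC.
have C3_ge0 : 0 <= `|C3| * (R0 `^ gam + 1).
  by rewrite mulr_ge0// addr_ge0// powR_ge0.
have rho1 : `|C3| * ((R0 / 2 ^+ n1) `^ gam + delta `^ vtheta) < a * r.
  apply: (@le_lt_trans _ _ (`|C3| * (R0 `^ gam + 1) * r)).
    by rewrite -mulrA ler_wpM2l// deltaE mulrDl mul1r lerD2r.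
  by rewrite ltr_pM2r// /a -addrA ltrDl addr_gt0// mulr_gt0.
have rho2 : 4 * L (n2%:R * tau) * eps + R0 / 2 ^+ n2 <= a * r.
  apply: (@le_trans _ _ ((4 * c1 + R0) * r)).
    by rewrite [X in _ <= X]mulrDl lerD// -!(mulrA 4) ler_pM2l.
  by rewrite ler_pM2r// /a -addrA lerDr.
have epsm : 0 < eps < rm by rewrite eps0 (le_lt_trans epsr).
have epsp : 0 < eps < rp by rewrite eps0 (le_lt_trans epsr).
have covA := attractor_cover delta0 mtau n2tau n2q eps0 rho1 rho2 qeps
  (covm _ epsm) (covp _ epsp).
rewrite mulrDl; apply: covered_sub covA => //.
have rV s : r `^ (- s) = r^-1 `^ s.
  by rewrite -(powR_inv1 (ltW r0)) -powRrM mulN1r.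
rewrite [X in _ <= _ * X]rV; apply: le_trans Nle.
by rewrite [2 * _]mulr_natl mulr2n.
Qed.

End dynamics.

(** * Existence of the attractor and the final estimate *)

Unset Implicit Arguments.
Set Strict Implicit.

(* The space Y is presented by its embedding [iota] into X, so that
   "||v||_Y <= M" for v in X reads: v = iota z for some z in Y, `|z| <= M. *)
Theorem theorem2 (R : realType) (Xi : completeMetricType R)
  (X Y : completeNormedModType R) (iota : {linear Y -> X})
  (theta : R -> Xi -> Xi) (g : Xi) (Sigma : set Xi)
  (U : Xi -> R -> R -> X -> X) (B : set X)
  (kappa C3 L : R -> R) (gam vtheta P zeta c1 beta : R)
  (Sigmam Sigmap : set Xi) (eta1 eta2 C tau : R) :
  continuous_group theta ->
  Sigma = hull theta g ->
  evolution_system theta Sigma U ->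
  closed B -> bounded_set B -> uniformly_absorbing Sigma U B ->
  (* (1) *)
  compact_embedding iota ->
  (* (2) *)
  (forall t, 0 < t -> 0 < kappa t /\
    forall sigma x y, Sigma sigma -> B x -> B y ->
      exists2 z : Y, iota z = U sigma t 0 x - U sigma t 0 y
                   & `|z| <= kappa t * `|x - y|) ->
  (* (3) *)
  0 < gam -> 0 < vtheta ->
  (forall r, 0 < r -> forall s sigma x y t t',
    Sigma sigma -> B x -> B y -> 0 <= t <= r -> 0 <= t' <= r ->
    `|U sigma (t + s) s x - U sigma (t' + s) s y|
      <= C3 r * (`|x - y| `^ gam + `|t - t'| `^ vtheta)) ->
  (* (4) *)
  1 <= P -> 0 < zeta ->
  (forall t xi1 xi2, 0 <= t ->
    mdist (theta t xi1) (theta t xi2) <= P * expR (zeta * t) * mdist xi1 xi2) ->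
  (* (5) *)
  0 < c1 -> 0 < beta ->
  (forall t, 1 <= t -> 1 <= L t <= c1 * expR (beta * t)) ->
  (forall t sigma1 sigma2 x, 1 <= t -> Sigma sigma1 -> Sigma sigma2 -> B x ->
    `|U sigma1 t 0 x - U sigma2 t 0 x| <= L t * mdist sigma1 sigma2) ->
  (* the asymptotic symbol sets *)
  compact Sigmam -> invariant_set theta Sigmam -> box_dim Sigmam \is a fin_num ->
  compact Sigmap -> invariant_set theta Sigmap -> box_dim Sigmap \is a fin_num ->
  alpha_limit theta g `<=` Sigmam -> omega_limit theta g `<=` Sigmap ->
  0 < eta1 -> 0 < eta2 -> 1 <= C ->
  (forall t, (dist_set (theta t g) Sigmam <= (C * expR (eta1 * t))%:E)%E) ->
  (forall t, (dist_set (theta t g) Sigmap <= (C * expR (- (eta2 * t)))%:E)%E) ->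
  (* absorption time of B into itself *)
  0 < tau ->
  (forall t, tau <= t ->
    \bigcup_(sigma in Sigma) (U sigma t 0 @` B) `<=` B) ->
  exists A : set X,
    [/\ uniform_attractor Sigma U A,
        box_dim A \is a fin_num
      & (box_dim A <=
           (vtheta^-1)%:E
           + (gam^-1)%:E *
               (lne (covering_number (iota @` ball (0 : Y)%R 1%R)
                       (4 * kappa tau)^-1%R) / (ln 2)%:E)
           + ((beta + zeta) * tau / ln 2 + 1)%:E
             * maxe (box_dim Sigmam) (box_dim Sigmap))%E].
Proof.
move=> th_group -> Usys Bcl Bbnd Babs icomp smooth g0 th0 hold _ zeta0 _.
move=> c10 beta0 Lb slip Smc _ Smfin Spc _ Spfin _ _ eta10 eta20 C1 Smdist Spdist.
move=> tau0 tauB.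
set S := hull theta g in Usys Babs smooth hold slip tauB *.
have hold' r : 0 < r -> forall sigma x y t t', S sigma -> B x -> B y ->
    0 <= t <= r -> 0 <= t' <= r ->
    `|U sigma t 0 x - U sigma t' 0 y|
      <= C3 r * (`|x - y| `^ gam + `|t - t'| `^ vtheta).
  move=> r0 sigma x y t t' Ss Bx By tr t'r.
  by have := hold r r0 0 sigma x y t t' Ss Bx By tr t'r; rewrite !addr0.
have L1 t : 1 <= t -> 1 <= L t by move=> /Lb/andP[].
have S0 : S !=set0 by exists (theta 0 g); apply: subset_closure; exists 0.
have tauabs t sigma x : tau <= t -> S sigma -> B x -> B (U sigma t 0 x).
  by move=> tt Ss Bx; apply: (tauB t tt); exists sigma => //; exists x.
(* [B] absorbs the singleton of 0, hence is nonempty. *)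
have [b0 Bb0] : B !=set0.
  have [sigma Ss] := S0.
  have [|tD _ DB] := Babs [set 0]; first exact/compact_bounded/compact_set1.
  exists (U sigma tD 0 0); apply: (DB tD sigma) => //.
  by exists 0.
have [R0 BR0] : exists R0 : R, B `<=` ball b0 R0.
  have [M [_ Mb]] := Bbnd; pose M1 := M + 1.
  have Mx x : B x -> `|x| <= M1 by apply: Mb; rewrite ltrDl.
  exists (M1 + M1 + 1) => x Bx; apply/ball_normP.
  apply: (le_lt_trans (ler_normB _ _)).
  by apply: (@le_lt_trans _ _ (M1 + M1)); rewrite ?ltrDl// lerD ?Mx.
have [kt0 _] := smooth tau tau0.
have [N [NE Ncov]] : exists N : nat,
    covering_number (iota @` ball (0 : Y) 1) (4 * kappa tau)^-1 = N%:R%:E /\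
    covered (iota @` ball (0 : Y) 1) (4 * kappa tau)^-1 N%:R.
  have [_ _ ic] := icomp.
  have [||M Mcov] := @precompact_covered _ X (iota @` ball (0 : Y) 1)
    (4 * kappa tau)^-1.
  - apply: ic; exists 1; split; first exact: num_real.
    move=> M /ltW M1 z /ball_normP; rewrite sub0r normrN => /ltW/le_trans; exact.
  - by rewrite invr_gt0 mulr_gt0.
  exact: covering_number_fin Mcov.
have N0 : (0 < N)%N.
  have := @covering_number_ge1 _ _ (iota @` ball (0 : Y) 1) (4 * kappa tau)^-1.
  rewrite NE lee_fin ler1n; apply.
  by exists (iota 0); exists 0 => //; exact: ballxx.
have [K [T0 [Kc KB]]] := orbit_tail_compact Usys Bb0 BR0 icomp smooth
  L1 slip tau0 tauabs.
have [Aattr A0] := uniform_attractor_omega Usys S0 Bbnd (ex_intro _ b0 Bb0) Babs Kc KB.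
set A := \bigcap_t _ in Aattr A0.
(* The distance to the empty set is +oo, so a finite bound forces nonemptiness, and the dimensions
   of the symbol sets are nonnegative. *)
have nonempty (V : set Xi) t (e : R) : (dist_set (theta t g) V <= e%:E)%E -> V !=set0.
  move=> Ve; apply/set0P/eqP => V0; move: Ve; rewrite V0.
  by rewrite /dist_set image_set0 ereal_inf0.
have dimm0 : (0 <= box_dim Sigmam)%E := box_dim_ge0 (nonempty _ 0 _ (Smdist 0)).
have dimp0 : (0 <= box_dim Sigmap)%E := box_dim_ge0 (nonempty _ 0 _ (Spdist 0)).
pose dm := fine (box_dim Sigmam); pose dp := fine (box_dim Sigmap).
pose d := Num.max dm dp.
have dE : maxe (box_dim Sigmam) (box_dim Sigmap) = d%:E.
  by rewrite -(fineK Smfin) -(fineK Spfin) -EFin_max.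
have d0 : 0 <= d by rewrite le_max fine_ge0.
have l2 : (0 : R) < ln 2 by rewrite ln_gt0// ltr1n.
have l0 : 0 <= ln N%:R / ln 2 :> R by rewrite divr_ge0 ?ln_ge0 ?ler1n// ltW.
set D : R := vtheta^-1 + gam^-1 * (ln N%:R / ln 2) +
  ((beta + zeta) * tau / ln 2 + 1) * d.
have AD : (box_dim A <= D%:E)%E.
  have [gam1|gam1] := leP gam 1.
    have dimm : (box_dim Sigmam <= d%:E)%E by rewrite -dE le_max lexx.
    have dimp : (box_dim Sigmap <= d%:E)%E by rewrite -dE le_max lexx orbT.
    apply: (@le_trans _ _ (vtheta^-1 + gam^-1 * (ln N%:R / ln 2) +
      (beta * tau / ln 2 + 1) * d)%:E); last first.
      rewrite lee_fin lerD2l ler_wpM2r// lerD2r ler_pM2r ?invr_gt0//.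
      by rewrite ler_pM2r// lerDl ltW.
    apply: (attractor_box_dim_le th_group Usys Bb0 BR0 smooth L1 slip tau0
      tauabs Ncov g0 th0 (hold' tau tau0) eta10 eta20 C1 Smdist Spdist c10 beta0
      _ gam1 N0 d0 dimm dimp).
    by move=> t /Lb/andP[].
  (* For gam > 1 the Hölder estimate at t = t' = 0 concerns the identity and separates the points of
     [B]; the compact set [A] inside [B] then has dimension at most 0. *)
  apply: (@le_trans _ _ 0%E); last first.
    have kz : 0 <= (beta + zeta) * tau / ln 2 + 1.
      by rewrite addr_ge0// divr_ge0 ?(ltW l2)// ltW// mulr_gt0// addr_gt0.
    rewrite lee_fin; apply: addr_ge0; last exact: mulr_ge0.
    by apply: addr_ge0; [|apply: mulr_ge0 => //]; rewrite invr_ge0 ltW.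
  have [sigma Ss] := S0.
  have [e e0 Bsep] : exists2 e : R, 0 < e &
      forall x y, B x -> B y -> `|x - y| < e -> x = y.
    apply: (holder_gt1_separated (C := C3 1) gam1) => x y Bx By.
    have := hold' 1 ltr01 sigma x y 0 0 Ss Bx By.
    rewrite lexx ler01 subrr normr0 powR0 ?gt_eqF// addr0 => /(_ isT isT).
    by have [_ _ Up _] := Usys; have [_ -> _ _] := Up _ Ss.
  have AB : A `<=` B.
    move=> x /(_ tau I) xtau; apply: Bcl; apply: closure_subset xtau.
    by move=> _ [t [xi [z [tt Sxi Bz ->]]]]; exact: tauabs.
  have [Ac Acl _ _] := Aattr.
  have e20 : 0 < e / 2 by rewrite divr_gt0.
  have [|M Mcov] := @precompact_covered _ X A (e / 2) _ e20.
    by rewrite precompact_closed.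
  apply: (box_dim_separated e20 Mcov) => x y /AB Bx /AB By /ball_normP.
  by rewrite -splitr; exact: Bsep.
exists A; split=> //.
- rewrite ge0_fin_numE ?box_dim_ge0//.
  by rewrite (le_lt_trans AD)// ltry.
- by rewrite NE lne_EFin ?ltr0n// inver gt_eqF// dE -!EFinM -!EFinD.
Qed.
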